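(* Let $(X,A,W)$ be a complete convex $A$-metric space with convex structure $W$, where $A: X^t\to\mathbb{R}$, and let $f:X\to X$ be an $AZ$ mapping. For $i=1,2,\dots,t$ let $\{\alpha_i^n\}_{n\ge 0}$ be sequences in $[0,1]$ with $\sum_{i=1}^t \alpha_i^n=1$ for all $n\in\mathbb{N}=\{0,1,2,\dots\}$ and $\sum_{n=0}^\infty \alpha_t^n=\infty$. Let $x_0\in X$ and let $\{x_n\}$ be the sequence defined by the Mann iteration process $$x_{n+1}=W\left(x_n,x_n,\dots,x_n,fx_n;\alpha_1^n,\alpha_2^n,\dots,\alpha_t^n\right),\qquad n\in\mathbb{N}.$$ Then $\{x_n\}$ converges to a unique fixed point of $f$ (that is, $f$ has a unique fixed point and $\{x_n\}$ converges to it).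
   Context: Fix an integer $t\ge 2$ and let $I=[0,1]$. **$A$-metric space.** Let $X$ be a nonempty set. $(X,A)$ is an $A$-metric space if $A:X^t\to\mathbb{R}$ satisfies, for all $x_1,\dots,x_t,y\in X$: (A1) $A(x_1,\dots,x_t)\ge 0$; (A2) $A(x_1,\dots,x_t)=0$ if and only if $x_1=x_2=\dots=x_t$; (A3) $A(x_1,x_2,\dots,x_t)\le \sum_{i=1}^t A(x_i,x_i,\dots,x_i,y)$, where in each term on the right $x_i$ fills the first $t-1$ slots and $y$ the last slot. Throughout, $A(x,x,\dots,x,y)$ denotes the value of $A$ with $x$ in the first $t-1$ slots and $y$ in the last slot. **Convergence and completeness.** A sequence $\{x_n\}$ in $X$ converges to $u\in X$ if $A(x_n,x_n,\dots,x_n,u)\to 0$ as $n\to\infty$. It is Cauchy if $A(x_n,x_n,\dots,x_n,x_m)\to 0$ as $n,m\to\infty$. $(X,A)$ is complete if every Cauchy sequence in $X$ converges to a point of $X$. **Convex structure.** A mapping $W:X^t\times I^t\to X$ is a convex structure on $(X,A)$ if $$A\bigl(u_1,\dots,u_{t-1},W(x_1,\dots,x_t;a_1,\dots,a_t)\bigr)\le \sum_{i=1}^t a_i\,A(u_1,\dots,u_{t-1},x_i)$$ for all $a_1,\dots,a_t\in I$ with $\sum_{i=1}^t a_i=1$, and all $u_1,\dots,u_{t-1},x_1,\dots,x_t\in X$. An $A$-metric space with a convex structure $W$ is called a convex $A$-metric space, written $(X,A,W)$; it is complete if $(X,A)$ is complete. **$AZ$ mapping ($A$-Zamfirescu mapping).**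 A map $f:X\to X$ is an $AZ$ mapping if there are real numbers $a,b,c$ with $0\le a<1$ and $0\le b,c<\frac1t$ such that for all $x,y\in X$ at least one of the following holds: (AZ1) $A(fx,\dots,fx,fy)\le a\,A(x,\dots,x,y)$; (AZ2) $A(fx,\dots,fx,fy)\le b\,[A(fx,\dots,fx,x)+A(fy,\dots,fy,y)]$; (AZ3) $A(fx,\dots,fx,fy)\le c\,[A(fx,\dots,fx,y)+A(fy,\dots,fy,x)]$. *)

(* Defs.v *)
From mathcomp Require Import all_boot all_order all_algebra.
From mathcomp Require Import all_classical all_reals all_analysis.

Set Implicit Arguments.
Unset Strict Implicit.
Unset Printing Implicit Defensive.

Import Order.TTheory GRing.Theory Num.Theory.
Import numFieldNormedType.Exports.

Local Open Scope classical_set_scope.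
Local Open Scope ring_scope.

(* X^t is represented by 'I_t -> X, so the paper's slot i is the ordinal i - 1. *)

Lemma last_slot_subproof (t : nat) : (1 < t)%N -> (t.-1 < t)%N.
Proof. by case: t. Qed.

Definition last_slot (t : nat) (ht : (1 < t)%N) : 'I_t :=
  Ordinal (last_slot_subproof ht).

(* The t-tuple (u_1, ..., u_{t-1}, y): insub maps i : 'I_t to the
   corresponding element of 'I_t.-1, and to None exactly when i = t - 1. *)
Definition put_last (X : Type) (t : nat) (u : 'I_t.-1 -> X) (y : X) :
    'I_t -> X :=
  fun i => oapp u y (insub (val i)).

(* The t-tuple (x, ..., x, y). *)
Definition const_last (X : Type) (t : nat) (x y : X) : 'I_t -> X :=
  put_last (fun=> x) y.

Section AMetric.
Variables (R : realType) (X : Type) (t : nat).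
Implicit Types (A : ('I_t -> X) -> R) (x : 'I_t -> X) (s : nat -> X).

Record is_A_metric A : Prop := IsAMetric {
  A_metric_inhabited : inhabited X ;
  A_metric_ge0 : forall x, 0 <= A x ;
  A_metric_eq0 : forall x, A x = 0 <-> (forall i j, x i = x j) ;
  A_metric_triangle : forall x (y : X),
    A x <= \sum_(i < t) A (const_last (x i) y) }.

Definition A_converges A s (u : X) : Prop :=
  A (const_last (s n) u) @[n --> \oo] --> (0 : R).

Definition A_cauchy A s : Prop :=
  A (const_last (s nm.1) (s nm.2)) @[nm --> (\oo, \oo)] --> (0 : R).

Definition A_complete A : Prop :=
  forall s, A_cauchy A s -> exists u, A_converges A s u.

Definition is_convex_structure A
    (W : ('I_t -> X) -> ('I_t -> {i01 R}) -> X) : Prop :=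
  forall (u : 'I_t.-1 -> X) x (a : 'I_t -> {i01 R}),
    \sum_(i < t) (a i)%:num = 1 ->
    A (put_last u (W x a)) <= \sum_(i < t) (a i)%:num * A (put_last u (x i)).

Definition is_AZ_mapping A (f : X -> X) : Prop :=
  exists a b c : R,
    [/\ 0 <= a < 1, 0 <= b < t%:R^-1, 0 <= c < t%:R^-1 &
     forall x y : X,
     [\/ A (const_last (f x) (f y)) <= a * A (const_last x y),
         A (const_last (f x) (f y)) <=
           b * (A (const_last (f x) x) + A (const_last (f y) y)) |
         A (const_last (f x) (f y)) <=
           c * (A (const_last (f x) y) + A (const_last (f y) x))]].

End AMetric.

(* Main.v *)
Require Import Defs.
From mathcomp Require Import all_boot all_order all_algebra.
From mathcomp Require Import all_classical all_reals all_analysis.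
From mathcomp Require Import zify lra.

(** Put [d x y := A(x, ..., x, y)].  On the tuple [(x, ..., x, y)] with base
    point [x], all terms of the triangle axiom but the last vanish, which shows
    that [d] is symmetric; on [(x, ..., x, z)] with base point [y] it then reads
    [d x z <= (t - 1) * d x y + d y z].  So [d] is a metric up to a constant
    that affects one of the two sides only ([A_metric_strong_bmetric]), and
    completeness, convergence and the conditions on [f] only involve [d].

    For such a [d], each of the three Zamfirescu alternatives implies
    [d (f x) (f y) <= r * d x y + K * d x (f x)] and
    [d (f x) (f (f x)) <= r * d x (f x)] for a common [r < 1]
    ([zamfirescu_almost_contraction]): every distance on the right-hand side
    of an alternative is brought back to [d x y], [d x (f x)] and
    [d (f x) (f y)], and the last one is absorbed on the left.  The bound
    [1 / t] on [b] and [c] is exactly what makes the resulting rate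
    [(t - 1) * b / (1 - b)] smaller than 1.

    The second inequality makes the Picard iterates of [f] a Cauchy sequence:
    the one-sided triangle inequality telescopes with the constant [t - 1]
    appearing only once, so no smallness of [(t - 1) * r] is required
    ([picard_tail_bound]).  Their limit [p] is fixed by the first inequality
    ([almost_contraction_fixpoint]), which at [p] reads
    [d p (f y) <= r * d p y]; this gives uniqueness.

    Finally the Mann step is a point of the segment from [x_n] to [f x_n], so
    that, with [w_n] the weight of the last slot, convexity gives
    [d p x_(n+1) <= (1 - (1 - r) * w_n) * d p x_n].  Since the [w_n] have a
    divergent sum, this forces [d p x_n --> 0] ([cvg0_damped_recursion]). *)

Set Implicit Arguments.
Unset Strict Implicit.
Unset Printing Implicit Defensive.

Import Order.TTheory GRing.Theory Num.Theory.
Import numFieldNormedType.Exports.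

Local Open Scope classical_set_scope.
Local Open Scope ring_scope.

(** * Zamfirescu mappings of strong b-metric spaces *)

Section StrongBMetric.

Context {R : realType} {X : Type}.
Implicit Types (d : X -> X -> R) (s a b c : R) (f : X -> X) (p : X).

(** The strong b-metrics of Kirk and Shahzad: unlike in a b-metric, only one
    summand of the triangle inequality carries the constant. *)
Record is_strong_bmetric s d : Prop := IsStrongBMetric {
  bmetric_ge0 : forall x y, 0 <= d x y;
  bmetric_xx : forall x, d x x = 0;
  bmetric_eq : forall x y, d x y = 0 -> x = y;
  bmetric_sym : forall x y, d x y = d y x;
  bmetric_triangle : forall x y z, d x z <= s * d x y + d y z }.

Definition zamfirescu d f a b c : Prop := forall x y,
  [\/ d (f x) (f y) <= a * d x y,
      d (f x) (f y) <= b * (d (f x) x + d (f y) y) |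
      d (f x) (f y) <= c * (d (f x) y + d (f y) x)].

(** One rate for the three alternatives.  The quotients [s * b / (1 - b)] and
    [s * c / (1 - c)] appear when the term [d (f x) (f y)] of the right-hand
    side is absorbed on the left; they are below 1 because
    [b * (s + 1) < 1] and [c * (s + 1) < 1]. *)
Lemma zamfirescu_rate s a b c : 1 <= s -> 0 <= a < 1 ->
    0 <= b -> b * (s + 1) < 1 -> 0 <= c -> c * (s + 1) < 1 ->
  exists r, [/\ 0 <= r < 1, a <= r, s * b <= r * (1 - b) & s * c <= r * (1 - c)].
Proof.
move=> s1 /andP[a0 a1] b0 bs c0 cs.
have b1 : 0 < 1 - b by nra.
have c1 : 0 < 1 - c by nra.
exists (Num.max a (Num.max (s * b / (1 - b)) (s * c / (1 - c)))); split.
- by rewrite le_max a0 /= !gt_max a1 !ltr_pdivrMr // !mul1r; apply/andP; split; lra.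
- by rewrite le_max lexx.
- by rewrite -ler_pdivrMr // !le_max lexx orbT.
- by rewrite -ler_pdivrMr // !le_max lexx !orbT.
Qed.

(** The first estimate is a weak contraction in the sense of Berinde, whose
    error term [d x (f x)] vanishes at fixed points and along the Picard
    iteration.  The second one is not a consequence of it, as [r + K] need not
    be below 1: it comes from the same alternatives, taken at
    [y = f x], where [d (f y) y] is the left-hand side itself and [d (f x) y]
    is 0. *)
Lemma zamfirescu_almost_contraction s d f a b c :
    is_strong_bmetric s d -> 1 <= s -> 0 <= a < 1 ->
    0 <= b -> b * (s + 1) < 1 -> 0 <= c -> c * (s + 1) < 1 ->
    zamfirescu d f a b c ->
  exists r K, [/\ 0 <= r < 1,
    forall x y, d (f x) (f y) <= r * d x y + K * d x (f x) &
    forall x, d (f x) (f (f x)) <= r * d x (f x)].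
Proof.
move=> dm s1 a01 b0 bs c0 cs fz.
have [r [r01 ar br cr]] := zamfirescu_rate s1 a01 b0 bs c0 cs.
have d0 := bmetric_ge0 dm; have dC := bmetric_sym dm.
have dT := bmetric_triangle dm.
have b1 : 0 < 1 - b by nra.
have c1 : 0 < 1 - c by nra.
(* These make a coefficient [b] or [c] divided by [1 - b] or [1 - c] at most 1. *)
have b2 : b <= 1 - b by nra.
have c2 : c <= 1 - c by nra.
(* The second alternative yields the coefficient [b / (1 - b) * (1 + s^2)] of
   [d x (f x)], and the third one [c / (1 - c) * (2 * s)]. *)
exists r, (1 + s ^+ 2); split=> // [x y|x].
- have Dxy := d0 x y; have Dx := d0 x (f x).
  have Kx : 0 <= (1 + s ^+ 2) * d x (f x) by nra.
  have E1 : d (f x) y <= s * d x (f x) + d x y by rewrite (dC x (f x)).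
  have [h|h|h] := fz x y.
  + by have := ler_wpM2r Dxy ar; lra.
  + have E2 : d (f y) y <= s * d (f x) y + d (f x) (f y).
      by rewrite (dC (f y)) (dC (f x) y).
    rewrite (dC (f x) x) in h.
    rewrite -(ler_pM2l b1).
    have H1 := ler_wpM2r Dxy br.
    have H2 := ler_wpM2r Kx b2.
    have s0 : 0 <= s by lra.
    have H3 := ler_wpM2l b0 (ler_wpM2l s0 E1).
    have H4 := ler_wpM2l b0 E2.
    by lra.
  + have E2 : d (f y) x <= s * d x (f x) + d (f x) (f y) by rewrite (dC (f y)).
    rewrite -(ler_pM2l c1).
    have H0 : c * d x y <= s * c * d x y by rewrite ler_wpM2r // ler_peMl.
    have H1 := ler_wpM2r Dxy cr.
    have H2 := ler_wpM2r Kx c2.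
    have H3 := ler_wpM2l c0 E1.
    have H4 := ler_wpM2l c0 E2.
    (* This is [2 * s <= 1 + s^2], scaled. *)
    have H5 := mulr_ge0 c0 (mulr_ge0 (sqr_ge0 (s - 1)) Dx).
    by lra.
- have Dx := d0 x (f x).
  have [h|h|h] := fz x (f x).
  + by have := ler_wpM2r Dx ar; lra.
  + rewrite -(ler_pM2l b1).
    rewrite (dC (f x) x) (dC (f (f x)) (f x)) in h.
    have H0 : b * d x (f x) <= s * b * d x (f x) by rewrite ler_wpM2r // ler_peMl.
    have H1 := ler_wpM2r Dx br.
    by lra.
  + rewrite -(ler_pM2l c1).
    rewrite (bmetric_xx dm) (dC (f (f x)) x) in h.
    have H1 := ler_wpM2r Dx cr.
    have H4 := ler_wpM2l c0 (dT x (f x) (f (f x))).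
    by lra.
Qed.

(** Only the first summand of the triangle inequality carries the factor [s],
    and it is the one that bounds a single step.  Peeling steps off from the
    left therefore yields [s] times a geometric series, whatever [s] and
    [r < 1] are, where a general b-metric would produce powers of [s]. *)
Lemma picard_tail_bound s d r (u : nat -> X) :
    is_strong_bmetric s d -> 0 <= s -> 0 <= r < 1 ->
    (forall n, d (u n.+1) (u n.+2) <= r * d (u n) (u n.+1)) ->
  forall n m, (n <= m)%N ->
    d (u n) (u m) <= s * d (u 0) (u 1) / (1 - r) * r ^+ n.
Proof.
move=> dm s0 /andP[r0 r1] ur n m.
have geo k : d (u k) (u k.+1) <= r ^+ k * d (u 0) (u 1).
  elim: k => [|k IH]; first by rewrite expr0 mul1r.
  by rewrite exprS -mulrA (le_trans (ur k)) // ler_wpM2l.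
set C := s * _ / _.
have CE : C * (1 - r) = s * d (u 0) (u 1).
  by rewrite /C divfK // subr_eq0 gt_eqF.
have C0 : 0 <= C.
  by rewrite /C divr_ge0 ?subr_ge0 ?(ltW r1) ?mulr_ge0 ?(bmetric_ge0 dm).
move=> /subnKC <-; move: (m - n)%N => k {m}; elim: k n => [n|k IH n].
  by rewrite addn0 (bmetric_xx dm) mulr_ge0 // exprn_ge0.
rewrite addnS -addSn (le_trans (bmetric_triangle dm _ (u n.+1) _)) //.
have := IH n.+1; have := ler_wpM2l s0 (geo n).
have -> : s * (r ^+ n * d (u 0) (u 1)) = C * (1 - r) * r ^+ n.
  by rewrite CE mulrCA mulrC.
by rewrite exprS; lra.
Qed.

Definition bmetric_cvg d (u : nat -> X) p := d (u n) p @[n --> \oo] --> (0 : R).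

Definition bmetric_cauchy d (u : nat -> X) :=
  d (u nm.1) (u nm.2) @[nm --> (\oo, \oo)] --> (0 : R).

Lemma picard_cauchy s d r (u : nat -> X) :
    is_strong_bmetric s d -> 0 <= s -> 0 <= r < 1 ->
    (forall n, d (u n.+1) (u n.+2) <= r * d (u n) (u n.+1)) ->
  bmetric_cauchy d u.
Proof.
move=> dm s0 r01 ur; have tail := picard_tail_bound dm s0 r01 ur.
move: r01 => /andP[r0 r1].
set C := s * _ / _ in tail.
have C0 : 0 <= C.
  by rewrite /C divr_ge0 ?subr_ge0 ?(ltW r1) ?mulr_ge0 ?(bmetric_ge0 dm).
have Crn : C * r ^+ n @[n --> \oo] --> (0 : R).
  rewrite -[X in _ --> X](mulr0 C); apply: cvgMl_tmp.
  by apply: cvg_expr; rewrite ger0_norm.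
have bound n m : d (u n) (u m) <= C * r ^+ n + C * r ^+ m.
  have Cr k : 0 <= C * r ^+ k by rewrite mulr_ge0 // exprn_ge0.
  have [nm|/ltnW mn] := leqP n m.
    by rewrite (le_trans (tail _ _ nm)) // lerDl.
  by rewrite (bmetric_sym dm) (le_trans (tail _ _ mn)) // lerDr.
have lim0 : C * r ^+ nm.1 + C * r ^+ nm.2 @[nm --> (\oo, \oo)] --> (0 : R).
  rewrite -[X in _ --> X](addr0 0); apply: cvgD.
    by apply: (cvg_comp _ (fun n => C * r ^+ n) _ Crn); exact: cvg_fst.
  by apply: (cvg_comp _ (fun n => C * r ^+ n) _ Crn); exact: cvg_snd.
apply: (squeeze_cvgr _ (cvg_cst 0) lim0).
by apply: nearW => nm; rewrite (bmetric_ge0 dm) bound.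
Qed.

(** Let [u_n] be the Picard iterates and [p] their limit.  Then
    [d p (f p) <= s * d p u_(n+1) + d (f u_n) (f p)], and the last term is
    controlled by [r * d u_n p + K * d u_n u_(n+1)]: everything tends to 0. *)
Lemma almost_contraction_fixpoint s d f r K :
    is_strong_bmetric s d -> 0 <= s -> inhabited X ->
    (forall u, bmetric_cauchy d u -> exists p, bmetric_cvg d u p) ->
    0 <= r < 1 ->
    (forall x y, d (f x) (f y) <= r * d x y + K * d x (f x)) ->
    (forall x, d (f x) (f (f x)) <= r * d x (f x)) ->
  exists p, f p = p.
Proof.
move=> dm s0 [x0] dcomp r01 fK fr.
pose u n := iter n f x0.
have ucauchy : bmetric_cauchy d u.
  by apply: (picard_cauchy dm s0 r01) => n; exact: fr.
have [p up] := dcomp _ ucauchy.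
exists p; apply/esym/(bmetric_eq dm)/le_anti.
rewrite (bmetric_ge0 dm) andbT.
have upS : d (u n.+1) p @[n --> \oo] --> (0 : R) by rewrite (cvg_shiftS (fun n => d (u n) p)).
have step : d (u n) (u n.+1) @[n --> \oo] --> (0 : R).
  apply: (squeeze_cvgr _ (cvg_cst 0)
    (_ : s * d (u n) p + d (u n.+1) p @[n --> \oo] --> 0)).
    apply: nearW => n; rewrite (bmetric_ge0 dm) /=.
    by rewrite (bmetric_sym dm (u n.+1)) (bmetric_triangle dm).
  rewrite -[X in _ --> X](addr0 0); apply: cvgD => //.
  by rewrite -[X in _ --> X](mulr0 s); apply: cvgMl_tmp.
have lim0 : s * d (u n.+1) p + (r * d (u n) p + K * d (u n) (u n.+1))
    @[n --> \oo] --> (0 : R).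
  rewrite -[X in _ --> X](_ : s * 0 + (r * 0 + K * 0) = 0); last first.
    by rewrite !mulr0 !addr0.
  by apply: cvgD; [exact: cvgMl_tmp|apply: cvgD; exact: cvgMl_tmp].
rewrite -(cvg_lim (@Rhausdorff R) lim0).
apply: limr_ge; [by apply/cvg_ex; exists 0|apply: nearW => n].
apply: (le_trans (bmetric_triangle dm _ (u n.+1) _)).
by rewrite (bmetric_sym dm p) lerD2l; exact: fK.
Qed.

End StrongBMetric.

(** * Recursions damped by a divergent series *)

(** The quantity [e_n * (1 + k * S_n)], with [S_n] the partial sums of [w],
    does not increase, because [(1 - z) * (B + z) <= B] when [1 <= B] and
    [0 <= z].  This replaces the usual comparison of the product of the
    [1 - k * w_n] with [exp (- k * S_n)]. *)
Lemma cvg0_damped_recursion (R : realType) (e w : nat -> R) (k : R) :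
    0 < k -> (forall n, 0 <= e n) -> (forall n, 0 <= w n) ->
    (forall n, e n.+1 <= (1 - k * w n) * e n) ->
    \sum_(0 <= i < n) w i @[n --> \oo] --> +oo ->
  e n @[n --> \oo] --> (0 : R).
Proof.
move=> k0 e0 w0 ew wS.
pose S n := \sum_(0 <= i < n) w i.
have S0 n : 0 <= S n by apply: sumr_ge0.
have inv n : e n * (1 + k * S n) <= e 0.
  elim: n => [|n IH]; first by rewrite /S big_nil mulr0 addr0 mulr1.
  apply: le_trans IH.
  rewrite /S big_nat_recr //= -/(S n).
  have B0 : 0 <= 1 + k * (S n + w n) by rewrite addr_ge0 // mulr_ge0 ?addr_ge0 // ltW.
  apply: (le_trans (ler_wpM2r B0 (ew n))).
  have kw : 0 <= k * w n by rewrite mulr_ge0 // ltW.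
  have kS : 0 <= k * S n by rewrite mulr_ge0 // ltW.
  (* The defect in [(1 - z) * (B + z) <= B] is [z * (B - 1) + z^2], here with
     [z = k * w n] and [B = 1 + k * S n]. *)
  have H1 := mulr_ge0 (e0 n) (mulr_ge0 kw kS).
  have H2 := mulr_ge0 (e0 n) (mulr_ge0 kw kw).
  by lra.
apply/cvgr0Pnorm_lt => eps eps0.
(* Once [k * eps * S_n > e_0], the invariant forces [e_n < eps]. *)
move/cvgryPgt: wS => /(_ (e 0 / (k * eps))).
apply: filterS => n /=; rewrite -/(S n) => hS.
rewrite ger0_norm //.
have ke : 0 < k * eps by rewrite mulr_gt0.
move: hS; rewrite ltr_pdivrMr // => hS.
have P0 : 0 < 1 + k * S n by rewrite ltr_pwDl // mulr_ge0 // ltW.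
rewrite -(ltr_pM2r P0); apply: (le_lt_trans (inv n)).
by lra.
Qed.

(** * The two-point distance of an A-metric *)

Section AMetricDistance.

Context {R : realType} {X : Type} {t : nat} (ht : (1 < t)%N).
Implicit Types (A : ('I_t -> X) -> R).

Definition adist A (x y : X) : R := A (const_last x y).

Lemma const_last_last (x y : X) : const_last x y (last_slot ht) = y.
Proof. by rewrite /const_last /put_last insubF //= ltnn. Qed.

Lemma const_last_neq (x y : X) (i : 'I_t) :
  i != last_slot ht -> const_last x y i = x.
Proof.
move=> il; rewrite /const_last /put_last; case: insubP => //=.
have := ltn_ord i; move: il; rewrite -(inj_eq val_inj) /=; lia.
Qed.

Lemma const_last_id (x : X) (i : 'I_t) : const_last x x i = x.
Proof. by rewrite /const_last /put_last; case: insub. Qed.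

(** With unit weights this evaluates the right-hand side of the triangle axiom
    at [(x, ..., x, y)]; with the weights of a convex combination it shows that
    a Mann step only involves the weight of the last slot. *)
Lemma sum_const_last (w : 'I_t -> R) (F : X -> R) (x y : X) :
  \sum_i w i * F (const_last x y i) =
    (\sum_i w i - w (last_slot ht)) * F x + w (last_slot ht) * F y.
Proof.
rewrite (bigD1 (last_slot ht)) //= const_last_last addrC; congr (_ + _).
rewrite (bigD1 (last_slot ht) (F := w)) //= addrAC subrr add0r mulr_suml.
by apply: eq_bigr => i il; rewrite const_last_neq.
Qed.

Lemma A_metric_strong_bmetric A :
  is_A_metric A -> is_strong_bmetric (t.-1)%:R (adist A).
Proof.
move=> hA.
have xx x : adist A x x = 0.
  by apply/(A_metric_eq0 hA) => i j; rewrite !const_last_id.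
have tri x y z : adist A x z <= (t.-1)%:R * adist A x y + adist A z y.
  apply: (le_trans (A_metric_triangle hA _ y)).
  have := sum_const_last (fun=> 1) (fun v => adist A v y) x z.
  under eq_bigr do rewrite mul1r.
  rewrite sumr_const card_ord mul1r => ->.
  by rewrite -[X in X%:R - _](ltn_predK ht) -addn1 natrD addrK.
(* The triangle axiom at [(x, ..., x, y)] with base point [x]. *)
have le x y : adist A x y <= adist A y x.
  by have := tri x x y; rewrite xx mulr0 add0r.
have sym x y : adist A x y = adist A y x by apply/le_anti; rewrite !le.
split=> // [x y|x y|x y z].
- exact: A_metric_ge0.
- move=> /(A_metric_eq0 hA) /(_ (Ordinal (ltnW ht)) (last_slot ht)).
  rewrite const_last_last const_last_neq // -(inj_eq val_inj) /=; lia.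
- by rewrite (sym y).
Qed.

Lemma convex_structure_segment A W (p x y : X) (w : 'I_t -> {i01 R}) :
    is_convex_structure A W -> \sum_i (w i)%:num = 1 ->
  adist A p (W (const_last x y) w) <=
    (1 - (w (last_slot ht))%:num) * adist A p x +
    (w (last_slot ht))%:num * adist A p y.
Proof.
move=> hW w1; apply: (le_trans (hW (fun=> p) _ _ w1)).
by rewrite (sum_const_last (fun i => (w i)%:num) (adist A p)) w1.
Qed.

End AMetricDistance.

Theorem theorem2p1 (R : realType) (t : nat) (ht : (1 < t)%N) (X : Type)
    (A : ('I_t -> X) -> R) (W : ('I_t -> X) -> ('I_t -> {i01 R}) -> X)
    (f : X -> X) (alpha : 'I_t -> nat -> {i01 R}) (x0 : X) (x : nat -> X)
    (hA : is_A_metric A) (hAc : A_complete A) (hW : is_convex_structure A W)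
    (hf : is_AZ_mapping A f)
    (halpha : forall n : nat, \sum_(i < t) (alpha i n)%:num = 1)
    (halpha_last :
      \sum_(0 <= k < n) (alpha (last_slot ht) k)%:num @[n --> \oo] --> +oo)
    (hx0 : x 0%N = x0)
    (hx : forall n : nat,
      x n.+1 = W (const_last (x n) (f (x n))) (fun i => alpha i n)) :
  exists p : X,
    [/\ f p = p, (forall q : X, f q = q -> q = p) & A_converges A x p].
Proof.
have dm := A_metric_strong_bmetric ht hA.
have s1 : 1 <= (t.-1)%:R :> R by rewrite ler1n; lia.
have tE : (t.-1)%:R + 1 = t%:R :> R by rewrite natr1 prednK // ltnW.
have t0 : 0 < t%:R :> R by rewrite ltr0n ltnW.
have [a [b [c [a01 /andP[b0 bt] /andP[c0 ct] fz]]]] := hf.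
rewrite -div1r ltr_pdivlMr // -tE in bt.
rewrite -div1r ltr_pdivlMr // -tE in ct.
have [r [K [r01 fK fr]]] :=
  zamfirescu_almost_contraction dm s1 a01 b0 bt c0 ct fz.
have [p fp] := almost_contraction_fixpoint dm (le_trans ler01 s1)
  (A_metric_inhabited hA) hAc r01 fK fr.
move: r01 => /andP[r0 r1].
have fpr y : adist A p (f y) <= r * adist A p y.
  by have := fK p y; rewrite fp (bmetric_xx dm) mulr0 addr0.
exists p; split=> //.
- move=> q fq; apply/esym/(bmetric_eq dm)/le_anti.
  rewrite (bmetric_ge0 dm) andbT.
  have := fpr q; rewrite fq; have := bmetric_ge0 dm p q; nra.
- have : adist A p (x n) @[n --> \oo] --> (0 : R).
    apply: (@cvg0_damped_recursion _ _
      (fun n => (alpha (last_slot ht) n)%:num) (1 - r)) => //.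
    + by rewrite subr_gt0.
    + by move=> n; exact: (bmetric_ge0 dm).
    + move=> n; rewrite hx.
      apply: (le_trans (convex_structure_segment ht p (x n) (f (x n)) hW (halpha n))).
      have w0 : 0 <= (alpha (last_slot ht) n)%:num by [].
      have := ler_wpM2l w0 (fpr (x n)); lra.
  by under eq_cvg do rewrite (bmetric_sym dm).
Qed.
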